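(* Let $S$ be an operator system and let $J\subseteq S$ be the kernel of a completely contractive and completely positive map on $S$. There is a unique pair $(S/J,\phi)$ consisting of an operator system $S/J$ and a morphism $\phi:S\to S/J$ with the property that whenever $T$ is an operator system and $\psi:S\to T$ is a completely contractive and completely positive map with $J\subseteq\ker\psi$, then $\psi$ factors through $\phi$. In other words, there is a completely contractive and completely positive map $\omega:S/J\to T$ such that $\psi=\omega\circ\phi$.
   Context: A matrix ordered operator space is a self-adjoint operator space $E$ (with involution) together with a matrix cone, i.e. closed subsets $P_n\subseteq \mathcal{M}_n(E)_h$ ($n\in\mathbb{N}$) of self-adjoint elements with $P_n\cap -P_n=\{0\}$ and $AP_nA^*\subseteq P_m$ for all scalar matrices $A\in\mathcal{M}_{m,n}$; elements of $P_n$ are called positive. For a linear map $\phi$ put $\phi_n=\mathrm{id}_n\otimes\phi$; $\phi$ is completely contractive and completely positive if every $\phi_n$ is contractive and positive. $\mathrm{CCP}(E,\mathcal{M}_n)$ denotes the set of such maps $E\to\mathcal{M}_n$, where $\mathcal{M}_n$ is the algebra of complex $n\times n$ matrices. The partial unitization $E^\sharp$ is $E\oplus\mathbb{C}$, where $(x,\alpha)\in\mathcal{M}_n(E)_h\oplus(\mathcal{M}_n)_h$ is positive iff $\alpha\ge 0$ and $\phi_n(\alpha_\epsilon^{-1/2}x\alpha_\epsilon^{-1/2})\ge -1$ for all $\epsilon>0$ and $\phi\in\mathrm{CCP}(E,\mathcal{M}_n)$, with $\alpha_\epsilon=\alpha+\epsilon 1_n$; it is a unital operator system with order unit $(0,1)$,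 normed by $\|x\|=\inf\{\alpha>0: \left(\begin{smallmatrix}\alpha 1&x\\ x^*&\alpha1\end{smallmatrix}\right)\ge0\}$ at each matrix level. An operator system (possibly nonunital) is a complete matrix ordered operator space $S$ such that the inclusion $S\to S^\sharp$, $x\mapsto(x,0)$, is completely isometric. A morphism of operator systems is a completely contractive and completely positive map between them. A completely contractive and completely positive map on $S$ means such a map from $S$ into some operator system.
   Formalization: The property is read as the usual universal property: φ itself vanishes on J and the factorization ω is unique; uniqueness of (S/J, φ) is up to isomorphism. Without these additions uniqueness fails, since (S, id) also has the stated property. *)

(* Defs.v *)
From HB Require Import structures.
From mathcomp Require Import all_boot all_order all_algebra.
From mathcomp Require Import all_classical reals.
From mathcomp Require Import complex.

Set Implicit Arguments.
Unset Strict Implicit.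
Unset Printing Implicit Defensive.

Import Order.TTheory GRing.Theory Num.Theory Normc.

Local Open Scope ring_scope.
Local Open Scope complex_scope.
Local Open Scope classical_set_scope.
Local Open Scope sesquilinear_scope.

Section ScalarMatrices.
Variable R : realType.
Implicit Types m n : nat.

Definition l2norm n (v : 'cV[R[i]]_n) : R :=
  Num.sqrt (\sum_i normc (v i 0) ^+ 2).

Definition opnorm m n (A : 'M[R[i]]_(m, n)) : R :=
  sup [set l2norm (A *m v) | v in [set v : 'cV[R[i]]_n | l2norm v <= 1]].

(* The order of R[i] is partial: [0 <= z] says that z is real and >= 0. *)
Definition psd n (A : 'M[R[i]]_n) : Prop :=
  A ^t* = A /\ forall v : 'rV[R[i]]_n, 0 <= (v *m A *m v ^t*) 0 0.

(* A^{-1/2} by functional calculus; meaningful for A positive definite. *)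
Definition invsqrtmx n (A : 'M[R[i]]_n) : 'M[R[i]]_n :=
  invmx (spectralmx A)
  *m diag_mx (map_mx (fun z => (sqrtC z)^-1) (spectral_diag A))
  *m spectralmx A.

Definition flatmx k n (x : 'M['M[R[i]]_k]_n) : 'M[R[i]]_(\sum_(i < n) k) :=
  \mxblock_(i < n, j < n) x i j.

End ScalarMatrices.

(* The data of a *-vector space with matrix norms and distinguished sets of
   "positive" matrices, without any axiom.  Matrix levels are indexed by all
   n : nat; level 0 has a single element and carries no information. *)
Record moData (R : realType) := MoData {
  mo_sort :> lmodType R[i];
  mo_star : mo_sort -> mo_sort;
  mo_norm : forall n, 'M[mo_sort]_n -> R;
  mo_pos : forall n, 'M[mo_sort]_n -> Prop }.

Arguments mo_star {R m} _.
Arguments mo_norm {R m n} _.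
Arguments mo_pos {R m n} _.

Section MatrixOrdered.
Variable R : realType.
Implicit Types E F : moData R.

Definition mxstar E n (x : 'M[E]_n) : 'M[E]_n := map_mx mo_star x^T.

(* The product A x B of a matrix x over E by scalar matrices. *)
Definition mxsand (E : lmodType R[i]) m n p q (A : 'M[R[i]]_(m, n))
    (x : 'M[E]_(n, p)) (B : 'M[R[i]]_(p, q)) : 'M[E]_(m, q) :=
  \matrix_(i, j) \sum_k \sum_l (A i k * B l j) *: x k l.

Definition star_axioms E : Prop :=
  [/\ forall x : E, mo_star (mo_star x) = x,
      forall x y : E, mo_star (x + y) = mo_star x + mo_star y
    & forall (c : R[i]) (x : E), mo_star (c *: x) = c^* *: mo_star x].

Definition norm_axioms E : Prop := forall n,
  [/\ forall x : 'M[E]_n, mo_norm x = 0 -> x = 0,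
      forall x y : 'M[E]_n, mo_norm (x + y) <= mo_norm x + mo_norm y
    & forall (c : R[i]) (x : 'M[E]_n),
        mo_norm (map_mx (fun e : E => c *: e) x) = normc c * mo_norm x].

(* Ruan's axioms: abstract operator spaces. *)
Definition ruan_axioms E : Prop :=
  (forall m n (x : 'M[E]_m) (y : 'M[E]_n),
     mo_norm (block_mx x 0 0 y) = Num.max (mo_norm x) (mo_norm y)) /\
  (forall m n (A : 'M[R[i]]_(m, n)) (x : 'M[E]_n) (B : 'M[R[i]]_(n, m)),
     mo_norm (mxsand A x B) <= opnorm A * mo_norm x * opnorm B).

Definition selfadjoint_operator_space E : Prop :=
  [/\ star_axioms E, norm_axioms E, ruan_axioms E
    & forall n (x : 'M[E]_n), mo_norm (mxstar x) = mo_norm x].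

Definition matrix_cone E : Prop :=
  [/\ forall n (x : 'M[E]_n), mo_pos x -> mxstar x = x,
      forall n (x y : 'M[E]_n), mo_pos x -> mo_pos y -> mo_pos (x + y),
      forall n (x : 'M[E]_n), mo_pos x /\ mo_pos (- x) <-> x = 0,
      forall m n (A : 'M[R[i]]_(m, n)) (x : 'M[E]_n),
        mo_pos x -> mo_pos (mxsand A x (A ^t*))
    & forall n (x : 'M[E]_n),
        (forall e : R, 0 < e -> exists2 p : 'M[E]_n, mo_pos p & mo_norm (x - p) < e) ->
        mo_pos x].

Definition matrix_ordered_operator_space E : Prop :=
  selfadjoint_operator_space E /\ matrix_cone E.

Definition complete_space E : Prop :=
  let nrm (x : E) := mo_norm (const_mx x : 'M[E]_1) in
  forall u : nat -> E,
    (forall e : R, 0 < e ->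
       exists N, forall m n, (N <= m)%N -> (N <= n)%N -> nrm (u m - u n) < e) ->
    exists l : E, forall e : R, 0 < e ->
      exists N, forall n, (N <= n)%N -> nrm (u n - l) < e.

Definition completely_contractive E F (f : {linear E -> F}) : Prop :=
  forall n (x : 'M[E]_n), mo_norm (map_mx f x) <= mo_norm x.

Definition completely_isometric E F (f : {linear E -> F}) : Prop :=
  forall n (x : 'M[E]_n), mo_norm (map_mx f x) = mo_norm x.

(* Positivity of a map concerns its action on self-adjoint elements, so that
   being self-adjoint is part of it; it follows from the second clause when
   the positive elements span a dense subspace, but not in general. *)
Definition completely_positive E F (f : {linear E -> F}) : Prop :=
  (forall x : E, f (mo_star x) = mo_star (f x)) /\
  (forall n (x : 'M[E]_n), mo_pos x -> mo_pos (map_mx f x)).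

Definition ccp E F (f : {linear E -> F}) : Prop :=
  completely_contractive f /\ completely_positive f.

(* The matrix algebra M_k, with M_n(M_k) = M_{nk}. *)
Definition mxalg (k : nat) : moData R := @MoData R 'M[R[i]]_k
  (fun A => A ^t*)
  (fun n x => opnorm (flatmx x))
  (fun n x => psd (flatmx x)).

Section PartialUnitization.
Variable E : moData R.

Let carrier : lmodType R[i] := (E * R[i]^o)%type.

Definition sharp_star (z : carrier) : carrier := (mo_star z.1, z.2^*).

Definition sharp_pos n (z : 'M[carrier]_n) : Prop :=
  let x : 'M[E]_n := map_mx fst z in
  let a : 'M[R[i]]_n := map_mx snd z in
  [/\ mxstar x = x, psd a
    & forall (e : R) (f : {linear E -> mxalg n}), 0 < e -> ccp f ->
        let b := invsqrtmx (a + (e%:C)%:M) in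
        psd (flatmx (map_mx f (mxsand b x b)) + 1%:M)].

(* The element t 1 of M_n(E^#), where 1 is the order unit (0, 1). *)
Definition sharp_scalar n (t : R) : 'M[carrier]_n :=
  \matrix_(i, j) (0, (t%:C)%:M i j).

Definition sharp_norm n (z : 'M[carrier]_n) : R :=
  inf [set t : R | 0 < t /\
    sharp_pos (block_mx (sharp_scalar n t) z
                        (map_mx sharp_star z^T) (sharp_scalar n t))].

Definition sharp : moData R :=
  @MoData R carrier sharp_star sharp_norm sharp_pos.

Definition sharp_incl (x : E) : sharp := (x, 0).

Lemma sharp_incl_is_linear : linear sharp_incl.
Proof.
move=> c x y; rewrite /sharp_incl.
by congr pair; rewrite /= scaler0 addr0.
Qed.

HB.instance Definition _ :=
  GRing.isLinear.Build R[i] E sharp *:%R sharp_incl sharp_incl_is_linear.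

End PartialUnitization.

Definition operator_system (S : moData R) : Prop :=
  [/\ matrix_ordered_operator_space S, complete_space S
    & completely_isometric (@sharp_incl S : {linear S -> sharp S})].

(* The universal property of the quotient of S by J. *)
Definition is_quotient (S : moData R) (J : set S)
    (Q : moData R) (f : {linear S -> Q}) : Prop :=
  [/\ operator_system Q, ccp f, (forall x, J x -> f x = 0)
    & forall (T : moData R) (g : {linear S -> T}),
        operator_system T -> ccp g -> (forall x, J x -> g x = 0) ->
        exists w : {linear Q -> T},
          [/\ ccp w, (forall x, g x = w (f x))
            & forall w' : {linear Q -> T},
                ccp w' -> (forall x, g x = w' (f x)) -> w' =1 w]].

End MatrixOrdered.

(* Main.v *)
Require Import Defs.
From HB Require Import structures.
From mathcomp Require Import all_boot all_order all_algebra.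
From mathcomp Require Import all_classical reals.
From mathcomp Require Import complex ring.
Import Order.TTheory GRing.Theory Num.Theory.

Set Implicit Arguments.
Unset Strict Implicit.
Unset Printing Implicit Defensive.

Local Open Scope ring_scope.
Local Open Scope complex_scope.
Local Open Scope classical_set_scope.
Local Open Scope sesquilinear_scope.

(** The quotient is built from its universal property.  Consider all morphisms
    [g] from [S] to operator systems [T] that vanish on [J].  Complete [S] for
    the seminorm [x |-> sup_g ||g x||], identifying elements at distance [0];
    since each [T] is complete, each [g] extends to the completion [Q]
    ([qextend]).  Give [M_n(Q)] the norm [sup_g ||g_n(x)||], and call [x]
    positive if every [g_n(x)] is.  Then each extended [g] is a morphism, so
    factorizations exist, and they are unique because the image of [S] is
    dense.

    It remains to see that [Q] is an operator system.  The axioms of matrix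
    ordered operator spaces pass from the spaces [T] to [Q], because the family
    of extended maps is separating ([initial_matrix_ordered]).  For the complete
    isometry of the inclusion of [Q] into its partial unitization, one
    inequality holds in every matrix ordered operator space: if
    [t > ||x||] then [(t, x; x^*, t)] is positive, since a self-adjoint
    contraction is at least [-1] ([sharp_pos_block]).  For the other one, the
    partial unitization of a morphism is positive ([sharp_pos_map]), so the norm
    of [(x, 0)] in the partial unitization of [Q] is at least that of [(g x, 0)]
    in the partial unitization of [T], which is [||g x||] because [T] is an
    operator system; take the supremum over [g] ([initial_sharp_isometric]).

    Two quotients are isomorphic by the usual argument
    ([is_quotient_unique]). *)

(** * Suprema of sets of reals, possibly empty *)

Section Supremum.
Variable R : realType.
Implicit Types (A : set R) (M : R).

Lemma sup_le_of A M : 0 <= M -> (forall a, A a -> a <= M) -> sup A <= M.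
Proof.
move=> M0 AM; have [->|/set0P A0] := eqVneq A set0; first by rewrite sup0.
exact: ge_sup.
Qed.

Lemma sup_ge_of A M a : (forall a, A a -> a <= M) -> A a -> a <= sup A.
Proof. by move=> AM; apply: ub_le_sup; exists M. Qed.

Lemma sup_nneg A M : (forall a, A a -> 0 <= a) -> (forall a, A a -> a <= M) ->
  0 <= sup A.
Proof.
move=> A0 AM; have [->|/set0P[a Aa]] := eqVneq A set0; first by rewrite sup0.
exact: le_trans (A0 _ Aa) (sup_ge_of AM Aa).
Qed.

End Supremum.

(** * Operator norms and positivity of scalar matrices *)

Section ScalarLemmas.
Variable R : realType.
Implicit Types m n : nat.
Local Notation normc := Normc.normc.

Lemma normr_normc (z : R[i]) : `|z| = (normc z)%:C.
Proof. by rewrite normc_def /normc; case: z. Qed.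

Lemma normc_ge0 (z : R[i]) : 0 <= normc z.
Proof. by rewrite -ler0c -normr_normc. Qed.

Lemma l2norm_ge0 n (v : 'cV[R[i]]_n) : 0 <= l2norm v.
Proof. exact: sqrtr_ge0. Qed.

Lemma l2norm_sqr n (v : 'cV[R[i]]_n) :
  l2norm v ^+ 2 = \sum_i normc (v i 0) ^+ 2.
Proof. by rewrite sqr_sqrtr// sumr_ge0// => i _; rewrite sqr_ge0. Qed.

Lemma l2norm_sqrE n (v : 'cV[R[i]]_n) :
  (l2norm v ^+ 2)%:C = (v ^t* *m v) 0 0.
Proof.
rewrite l2norm_sqr rmorph_sum/= mxE; apply: eq_bigr => i _.
by rewrite !mxE rmorphXn/= -normr_normc sqr_normc mulrC.
Qed.

Lemma l2norm_coord n (v : 'cV[R[i]]_n) i : normc (v i 0) <= l2norm v.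
Proof.
rewrite -(ler_pXn2r (ltn0Sn 1)) ?nnegrE ?normc_ge0 ?l2norm_ge0//.
rewrite l2norm_sqr (bigD1 i)//= lerDl sumr_ge0// => j _.
by rewrite sqr_ge0.
Qed.

Lemma l2norm_eq0 n (v : 'cV[R[i]]_n) : l2norm v = 0 -> v = 0.
Proof.
move=> v0; apply/colP => i; rewrite mxE; apply: Normc.eq0_normc.
by apply/eqP; rewrite eq_le normc_ge0 -{1}v0 l2norm_coord.
Qed.

Lemma l2normZ n (c : R[i]) (v : 'cV[R[i]]_n) :
  l2norm (c *: v) = normc c * l2norm v.
Proof.
have c0 := normc_ge0 c.
rewrite /l2norm -[in RHS](ger0_norm c0) -sqrtr_sqr -sqrtrM ?sqr_ge0//.
congr Num.sqrt; rewrite mulr_sumr; apply: eq_bigr => i _.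
by rewrite mxE Normc.normcM exprMn.
Qed.

Lemma opnorm_bounded m n (A : 'M[R[i]]_(m, n)) : exists M,
  forall a, [set l2norm (A *m v) | v in [set v | l2norm v <= 1]] a -> a <= M.
Proof.
exists (Num.sqrt (\sum_i (\sum_j normc (A i j)) ^+ 2)) => _ [v v1 <-].
rewrite ler_sqrt ?sumr_ge0// => [|i _]; last by rewrite sqr_ge0.
apply: ler_sum => i _; rewrite ler_pXn2r ?nnegrE ?normc_ge0//; last first.
  by rewrite sumr_ge0// => j _; apply: normc_ge0.
rewrite -lecR -normr_normc mxE.
apply: le_trans (ler_norm_sum _ _ _) _; rewrite rmorph_sum/=.
apply: ler_sum => j _.
rewrite normr_normc lecR Normc.normcM ler_piMr ?normc_ge0//.
exact: le_trans (l2norm_coord v j) v1.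
Qed.

Lemma opnorm_ge0 m n (A : 'M[R[i]]_(m, n)) : 0 <= opnorm A.
Proof.
have [M AM] := opnorm_bounded A; apply: sup_nneg AM => _ [v _ <-].
exact: l2norm_ge0.
Qed.

Lemma opnorm_le1 m n (A : 'M[R[i]]_(m, n)) :
  (forall v, l2norm (A *m v) = l2norm v) -> opnorm A <= 1.
Proof. by move=> Av; apply: sup_le_of ler01 _ => _ [v v1 <-]; rewrite Av. Qed.

Lemma l2norm_mulmx_le m n (A : 'M[R[i]]_(m, n)) v :
  l2norm (A *m v) <= opnorm A * l2norm v.
Proof.
have [/l2norm_eq0->|v0] := eqVneq (l2norm v) 0.
  rewrite mulmx0 -(scale0r (0 : 'cV_m)) l2normZ Normc.normc0 mul0r.
  by rewrite mulr_ge0 ?opnorm_ge0 ?l2norm_ge0.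
have vp : 0 < l2norm v by rewrite lt_def v0 l2norm_ge0.
have [M AM] := opnorm_bounded A.
rewrite -ler_pdivrMr//; apply: (sup_ge_of AM).
have nr : normc (l2norm v)^-1%:C = (l2norm v)^-1.
  by apply: complexI; rewrite -normr_normc ger0_norm// ler0c invr_ge0 ltW.
exists ((l2norm v)^-1%:C *: v); rewrite /= ?l2normZ ?nr ?mulVf//.
by rewrite -scalemxAr l2normZ nr mulrC.
Qed.

(** A self-adjoint contraction [A] satisfies [A >= -1]: expand
    [0 <= ||(A + 1) v||^2 = ||A v||^2 + 2 <A v, v> + ||v||^2]. *)
Lemma psd_addmx1 n (A : 'M[R[i]]_n) :
  A ^t* = A -> opnorm A <= 1 -> psd (A + 1%:M).
Proof.
move=> Ah A1.
have Bh : (A + 1%:M) ^t* = A + 1%:M.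
  by rewrite linearD/= map_mxD Ah trmx1 map_mx1.
split=> // v; set w := v ^t*.
have vw : v = w ^t* by rewrite /w trmxCK.
have Aw : l2norm (A *m w) <= l2norm w.
  apply: le_trans (l2norm_mulmx_le _ _) _.
  by rewrite ler_piMl// l2norm_ge0.
have sqA : (A *m w) ^t* *m (A *m w) = v *m A *m A *m w.
  by rewrite trmx_mul map_mxM/= Ah -vw !mulmxA.
have sqB : ((A + 1%:M) *m w) ^t* *m ((A + 1%:M) *m w) =
    v *m A *m A *m w + (v *m A *m w) *+ 2 + v *m w.
  rewrite trmx_mul map_mxM/= Bh -vw !mulmxDl !mulmxDr !mulmxDl !mul1mx !mulmx1.
  by rewrite !mulmxA mulr2n !addrA.
have e1 := l2norm_sqrE (A *m w).
have e2 := l2norm_sqrE ((A + 1%:M) *m w).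
have e3 := l2norm_sqrE w.
rewrite sqA in e1; rewrite sqB 2!mxE -e1 [X in _ + X + _]mxE in e2.
rewrite -vw in e3; rewrite -e3 in e2.
rewrite mulmxDr mulmxDl mulmx1 mxE -e3.
have h : 0 <= (l2norm ((A + 1%:M) *m w) ^+ 2)%:C +
              (l2norm w ^+ 2 - l2norm (A *m w) ^+ 2)%:C.
  rewrite -rmorphD ler0c addr_ge0 ?sqr_ge0// subr_ge0.
  by rewrite ler_pXn2r ?nnegrE ?l2norm_ge0.
rewrite -(pmulrn_lge0 _ (ltn0Sn 1)); apply: le_trans h _; rewrite e2.
rewrite le_eqVlt; apply/orP; left; apply/eqP; rewrite rmorphB/=.
by rewrite mulrnDl !mulr2n; ring.
Qed.

(** The spectral decomposition of a scalar matrix is not canonical, but its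
    diagonal part is forced. *)
Lemma invsqrtmx_scalar n (c : R[i]) :
  invsqrtmx (c%:M : 'M[R[i]]_n) = ((sqrtC c)^-1)%:M.
Proof.
have U := spectral_unit (c%:M : 'M[R[i]]_n).
have /orthomx_spectralP E : (c%:M : 'M[R[i]]_n) \is normalmx.
  by apply/normalmxP; rewrite scalar_mxC.
have D : diag_mx (spectral_diag (c%:M : 'M[R[i]]_n)) = c%:M.
  move: E => /(congr1 (mulmx (spectralmx (c%:M : 'M[R[i]]_n)))).
  rewrite !mulmxA mulmxV// mul1mx scalar_mxC.
  move=> /(congr1 (mulmx^~ (invmx (spectralmx (c%:M : 'M[R[i]]_n))))).
  by rewrite !mulmxK.
have {}D : diag_mx (map_mx (fun z => (sqrtC z)^-1)
    (spectral_diag (c%:M : 'M[R[i]]_n))) = ((sqrtC c)^-1)%:M.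
  apply/matrixP => i j; move/matrixP/(_ i j): D; rewrite !mxE.
  by case: eqVneq => // _; rewrite !mulr1n => ->.
by rewrite /invsqrtmx D scalar_mxC -mulmxA mulVmx// mulmx1.
Qed.

End ScalarLemmas.

(** * Norm, involution and scalar multiplication in matrix spaces *)

(** The norm of the space itself, that is, of its first matrix level. *)
Definition nrm (R : realType) (E : moData R) (x : E) : R :=
  mo_norm (const_mx x : 'M[E]_1).

Section Spaces.
Variable R : realType.
Implicit Types (E F : moData R) (n : nat).
Local Notation normc := Normc.normc.

Section Norm.
Variable E : moData R.
Hypothesis Enorm : norm_axioms E.

Lemma mo_norm0 n : mo_norm (0 : 'M[E]_n) = 0.
Proof.
have [_ _ /(_ 0 0)] := Enorm n; rewrite Normc.normc0 mul0r => <-.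
by congr mo_norm; apply/matrixP => i j; rewrite !mxE scale0r.
Qed.

Lemma mo_normN n (x : 'M[E]_n) : mo_norm (- x) = mo_norm x.
Proof.
have [_ _ /(_ (-1) x)] := Enorm n; rewrite normcN Normc.normc1 mul1r => <-.
by congr mo_norm; apply/matrixP => i j; rewrite !mxE scaleN1r.
Qed.

Lemma mo_norm_ge0 n (x : 'M[E]_n) : 0 <= mo_norm x.
Proof.
have [_ /(_ x (- x)) + _] := Enorm n; rewrite subrr mo_norm0 mo_normN.
by rewrite -mulr2n pmulrn_lge0.
Qed.

End Norm.

Lemma mxsand_scalar E n (a b : R[i]) (x : 'M[E]_n) :
  mxsand a%:M x b%:M = map_mx (fun e : E => (a * b) *: e) x.
Proof.
apply/matrixP => i j; rewrite !mxE (bigD1 i)//= (bigD1 j)//= !mxE !eqxx !mulr1n.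
rewrite [X in _ + X + _]big1 ?addr0; last first.
  by move=> l lj; rewrite !mxE (negbTE lj) mulr0 scale0r.
rewrite big1 ?addr0// => k ki; rewrite big1// => l _.
by rewrite mxE eq_sym (negbTE ki) mul0r scale0r.
Qed.

Lemma map_mxsand E F (f : {linear E -> F}) m n p q (A : 'M[R[i]]_(m, n))
    (x : 'M[E]_(n, p)) (B : 'M[R[i]]_(p, q)) :
  map_mx f (mxsand A x B) = mxsand A (map_mx f x) B.
Proof.
apply/matrixP => i j; rewrite !mxE linear_sum; apply: eq_bigr => k _.
by rewrite linear_sum; apply: eq_bigr => l _; rewrite linearZ mxE.
Qed.

Lemma star0 E : star_axioms E -> mo_star (0 : E) = 0.
Proof.
case=> _ _ sZ; rewrite -{1}(scale0r (0 : E)) sZ.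
by rewrite conjC0 scale0r.
Qed.

Lemma starB E (x y : E) :
  star_axioms E -> mo_star (x - y) = mo_star x - mo_star y.
Proof.
case=> _ sD sZ; rewrite sD -scaleN1r sZ; congr (_ + _).
by rewrite conjCN1 scaleN1r.
Qed.

Lemma mxstarK E n (x : 'M[E]_n) : star_axioms E -> mxstar (mxstar x) = x.
Proof. by case=> sK _ _; apply/matrixP => i j; rewrite !mxE sK. Qed.

Lemma map_mxstar E F (f : {linear E -> F}) n (x : 'M[E]_n) :
  (forall a, f (mo_star a) = mo_star (f a)) ->
  map_mx f (mxstar x) = mxstar (map_mx f x).
Proof. by move=> fs; apply/matrixP => i j; rewrite !mxE fs. Qed.

Lemma flatmx_star k n (x : 'M[mxalg R k]_n) :
  (flatmx x) ^t* = flatmx (mxstar x).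
Proof. by apply/matrixP => i j; rewrite !mxE. Qed.

Lemma psd_scalar n (t : R) : 0 <= t -> psd ((t%:C)%:M : 'M[R[i]]_n).
Proof.
move=> t0; split.
  rewrite tr_scalar_mx map_scalar_mx/=; congr _%:M.
  by rewrite conj_Creal// ger0_real// ler0c.
move=> v; rewrite mul_mx_scalar -scalemxAl mxE mulr_ge0 ?ler0c//.
have := l2norm_sqrE (v ^t*); rewrite trmxCK => <-.
by rewrite ler0c sqr_ge0.
Qed.

(** The unitary exchanging the two summands of [C^n + C^n]. *)
Definition swapmx n : 'M[R[i]]_(n + n) := block_mx 0 1%:M 1%:M 0.

Lemma opnorm_swapmx n : opnorm (swapmx n) <= 1.
Proof.
apply: opnorm_le1 => v; rewrite -[v]vsubmxK /swapmx mul_block_col.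
rewrite !mul0mx !mul1mx add0r addr0 /l2norm; congr Num.sqrt.
rewrite !big_split_ord/= addrC; congr (_ + _); apply: eq_bigr => i _.
  by rewrite !col_mxEd col_mxEu.
by rewrite col_mxEd !col_mxEu.
Qed.

(** Multiplying by a unitary moves the diagonal blocks off the diagonal. *)
Lemma mxsand_swapmx E n (x y : 'M[E]_n) :
  mxsand 1%:M (block_mx x 0 0 y) (swapmx n) = block_mx 0 x y 0.
Proof.
have sum1 k (i j : 'I_k) (z : 'M[E]_k) :
    \sum_l (1%:M l j : R[i]) *: z i l = z i j.
  rewrite (bigD1 j)//= mxE eqxx scale1r big1 ?addr0// => l lj.
  by rewrite mxE (negbTE lj) scale0r.
have sum0 k (i j : 'I_k) (z : 'M[E]_k) :
    \sum_l ((0 : 'M[R[i]]_k) l j : R[i]) *: z i l = 0.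
  by rewrite big1// => l _; rewrite mxE scale0r.
have zE (a b : 'I_n) : (0 : 'M[E]_n) a b = 0 by rewrite mxE.
apply/matrixP => i j; rewrite mxE (bigD1 i)//= [X in _ + X]big1 ?addr0.
  under eq_bigr do rewrite [1%:M i i]mxE eqxx mul1r.
  rewrite big_split_ord/= /swapmx.
  case: (split_ordP i) => i' ->; case: (split_ordP j) => j' ->.
  - under eq_bigr do rewrite !block_mxEul.
    under [X in _ + X]eq_bigr do rewrite block_mxEur zE scaler0.
    by rewrite sum0 big1 // addr0 block_mxEul mxE.
  - under eq_bigr do rewrite block_mxEul block_mxEur.
    under [X in _ + X]eq_bigr do rewrite block_mxEur zE scaler0.
    by rewrite sum1 big1 // addr0 block_mxEur.
  - under eq_bigr do rewrite block_mxEdl zE scaler0.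
    under [X in _ + X]eq_bigr do rewrite block_mxEdr block_mxEdl.
    by rewrite big1// add0r sum1 block_mxEdl.
  - under eq_bigr do rewrite block_mxEdl zE scaler0.
    under [X in _ + X]eq_bigr do rewrite !block_mxEdr.
    by rewrite big1// add0r sum0 block_mxEdr mxE.
move=> k ki; rewrite big1// => l _.
by rewrite mxE eq_sym (negbTE ki) mul0r scale0r.
Qed.

End Spaces.

Section FirstLevel.
Variables (R : realType) (E : moData R).
Hypothesis En : norm_axioms E.

Lemma nrm_ge0 (x : E) : 0 <= nrm x.
Proof. exact: mo_norm_ge0. Qed.

Lemma nrm0 : nrm (0 : E) = 0.
Proof. exact: mo_norm0. Qed.

Lemma nrm_eq0 (x : E) : nrm x = 0 -> x = 0.
Proof. by have [E0 _ _] := En 1; move=> /E0/matrixP/(_ 0 0); rewrite !mxE. Qed.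

Lemma nrmN (x : E) : nrm (- x) = nrm x.
Proof.
rewrite -[RHS]mo_normN//; congr mo_norm.
by apply/matrixP => i j; rewrite !mxE.
Qed.

Lemma nrmD (x y : E) : nrm (x + y) <= nrm x + nrm y.
Proof.
have [_ /(_ (const_mx x) (const_mx y)) + _] := En 1.
by apply: le_trans; rewrite le_eqVlt; apply/orP; left; apply/eqP;
   congr mo_norm; apply/matrixP => i j; rewrite !mxE.
Qed.

Lemma nrmZ c (x : E) : nrm (c *: x) = Normc.normc c * nrm x.
Proof.
have [_ _ <-] := En 1; congr mo_norm.
by apply/matrixP => i j; rewrite !mxE.
Qed.

Lemma nrmBC (x y : E) : nrm (x - y) = nrm (y - x).
Proof. by rewrite -nrmN opprB. Qed.

Lemma nrmB_trans (x y z : E) : nrm (x - z) <= nrm (x - y) + nrm (y - z).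
Proof. by apply: le_trans (nrmD _ _); rewrite addrA subrK. Qed.

Lemma nrm_le_eps (x : E) : (forall e, 0 < e -> nrm x <= e) -> x = 0.
Proof.
move=> xe; apply: nrm_eq0; apply/eqP; rewrite eq_le nrm_ge0 andbT.
by apply/ler_addgt0Pr => e e0; rewrite add0r xe.
Qed.

End FirstLevel.

Lemma nrm_star (R : realType) (E : moData R) (x : E) :
  selfadjoint_operator_space E -> nrm (mo_star x) = nrm x.
Proof.
case=> _ _ _ Es; rewrite /nrm -[in RHS]Es; congr mo_norm.
by apply/matrixP => i j; rewrite !mxE.
Qed.

Lemma nrm_contractive (R : realType) (E F : moData R) (f : {linear E -> F}) x :
  completely_contractive f -> nrm (f x) <= nrm x.
Proof.
move=> fc; apply: le_trans (fc _ _).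
rewrite le_eqVlt; apply/orP; left; apply/eqP.
by congr mo_norm; apply/matrixP => i j; rewrite !mxE.
Qed.

(** * Morphisms *)

Lemma ccp_id (R : realType) (E : moData R) : ccp (idfun : {linear E -> E}).
Proof.
have idE n (x : 'M[E]_n) : map_mx idfun x = x.
  by apply/matrixP => i j; rewrite !mxE.
by split=> [n x|]; [|split=> // n x]; rewrite idE.
Qed.

Lemma ccp_comp (R : realType) (A B C : moData R)
    (f : {linear A -> B}) (g : {linear B -> C}) :
  ccp f -> ccp g -> ccp (g \o f : {linear A -> C}).
Proof.
move=> [fc [fs fp]] [gc [gs gp]]; split=> [n x|].
  by rewrite map_mx_comp; apply: le_trans (gc _ _) (fc _ _).
split=> [x|n x x0]; first by rewrite /= fs gs.
by rewrite map_mx_comp; apply/gp/fp.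
Qed.

(** * The norm of a space inside its partial unitization *)

Section MatrixOrderedSpace.
Variables (R : realType) (E : moData R).
Hypothesis Emos : matrix_ordered_operator_space E.

Lemma mo_norm_offdiag n (x : 'M[E]_n) :
  mo_norm (block_mx 0 x (mxstar x) 0) <= mo_norm x.
Proof.
have [[_ Enorm [Emax Esand] Estar] _] := Emos.
rewrite -mxsand_swapmx; apply: le_trans (Esand _ _ _ _ _) _.
rewrite Emax Estar maxxx.
have N0 := mo_norm_ge0 Enorm x.
have o1 : opnorm (1%:M : 'M[R[i]]_(n + n)) <= 1.
  by apply: opnorm_le1 => v; rewrite mul1mx.
apply: (le_trans (y := opnorm (1%:M : 'M[R[i]]_(n + n)) * mo_norm x)).
  by rewrite ler_piMr ?opnorm_swapmx// mulr_ge0 ?opnorm_ge0.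
by rewrite ler_piMl.
Qed.

(** For [t >= ||x||] and [e > 0], the matrix
    [(t + e)^{-1/2} [0, x; x^*, 0] (t + e)^{-1/2}] is a self-adjoint
    contraction, so its image under a completely contractive self-adjoint map
    is at least [-1]. *)
Lemma sharp_pos_block n (x : 'M[E]_n) (t : R) : 0 < t -> mo_norm x <= t ->
  sharp_pos (block_mx (sharp_scalar E n t) (map_mx (@sharp_incl R E) x)
    (map_mx (@sharp_star R E) (map_mx (@sharp_incl R E) x)^T)
    (sharp_scalar E n t)).
Proof.
have [[Esa Enorm _ _] _] := Emos.
move=> t0 xt; set z := block_mx _ _ _ _.
have z1 : map_mx fst z = block_mx 0 x (mxstar x) 0.
  by rewrite map_block_mx; congr block_mx; apply/matrixP => i j; rewrite !mxE.
have z2 : map_mx snd z = (t%:C)%:M.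
  rewrite map_block_mx scalar_mx_block; congr block_mx; apply/matrixP => i j;
    rewrite !mxE//=.
  exact: conjC0.
have sa : mxstar (block_mx 0 x (mxstar x) 0) = block_mx 0 x (mxstar x) 0.
  rewrite /mxstar tr_block_mx map_block_mx !trmx0; congr block_mx.
  - by apply/matrixP => i j; rewrite !mxE star0.
  - exact: mxstarK.
  - by apply/matrixP => i j; rewrite !mxE star0.
split; rewrite ?z1 ?z2//; first exact: psd_scalar (ltW t0).
move=> e f e0 [fc [fs _]] /=.
rewrite -raddfD/= invsqrtmx_scalar mxsand_scalar -invfM -expr2 sqrtCK.
have te0 : 0 < t + e by rewrite addr_gt0.
rewrite -rmorphD/= -fmorphV/=; set y := map_mx _ (block_mx _ _ _ _).
apply: psd_addmx1.
  rewrite flatmx_star -map_mxstar//; congr (flatmx (map_mx f _)).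
  rewrite /y -[in RHS]sa; apply/matrixP => i j; rewrite !mxE.
  case: Esa => _ _ ->; congr (_ *: _); exact: conjc_real.
apply: le_trans (fc _ y) _; have [_ _ ->] := Enorm (n + n)%N.
have -> : Normc.normc ((t + e)^-1)%:C = (t + e)^-1.
  by apply: complexI; rewrite -normr_normc ger0_norm// ler0c invr_ge0 ltW.
rewrite mulrC ler_pdivrMr// mul1r.
apply: le_trans (mo_norm_offdiag x) _; apply: le_trans xt _.
by rewrite lerDl ltW.
Qed.

Lemma sharp_norm_set_lbound n (z : 'M[sharp E]_n) : lbound [set t : R | 0 < t /\
    sharp_pos (block_mx (sharp_scalar E n t) z
                        (map_mx (@sharp_star R E) z^T) (sharp_scalar E n t))] 0.
Proof. by move=> t [/ltW]. Qed.

(** The inclusion into the partial unitization is contractive for every matrix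
    ordered operator space; only isometry is a restriction. *)
Lemma sharp_norm_le n (x : 'M[E]_n) :
  mo_norm (map_mx (@sharp_incl R E) x : 'M[sharp E]_n) <= mo_norm x.
Proof.
have [[_ Enorm _ _] _] := Emos.
apply/ler_addgt0Pr => e e0; apply: ge_inf.
  by exists 0; exact: sharp_norm_set_lbound.
have xe : 0 < mo_norm x + e by rewrite ltr_wpDl ?mo_norm_ge0.
by split=> //; apply: sharp_pos_block => //; rewrite lerDl ltW.
Qed.

(** Witnesses that the infimum defining the norm of the partial unitization
    is taken over a nonempty set. *)
Lemma sharp_norm_set_nonempty n (x : 'M[E]_n) : [set t : R | 0 < t /\
    sharp_pos (block_mx (sharp_scalar E n t) (map_mx (@sharp_incl R E) x)
      (map_mx (@sharp_star R E) (map_mx (@sharp_incl R E) x)^T)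
      (sharp_scalar E n t))] !=set0.
Proof.
have [[_ Enorm _ _] _] := Emos; exists (mo_norm x + 1).
have t0 : 0 < mo_norm x + 1 by rewrite ltr_wpDl ?mo_norm_ge0.
by split=> //; apply: sharp_pos_block => //; rewrite lerDl.
Qed.

End MatrixOrderedSpace.

(** The partial unitization [w + id] of a morphism [w] is positive: compose the
    test maps on [B] with [w]. *)
Lemma sharp_pos_map (R : realType) (A B : moData R)
    (w : {linear A -> B}) n (z : 'M[sharp A]_n) :
  ccp w -> sharp_pos z ->
  sharp_pos (map_mx (fun a : sharp A => (w a.1, a.2) : sharp B) z).
Proof.
move=> wccp [z1 z2 zf]; have [_ [ws _]] := wccp.
have e1 : map_mx fst (map_mx (fun a : sharp A => (w a.1, a.2) : sharp B) z) =
    map_mx w (map_mx fst z) by rewrite -!map_mx_comp.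
have e2 : map_mx snd (map_mx (fun a : sharp A => (w a.1, a.2) : sharp B) z) =
    map_mx snd z by rewrite -!map_mx_comp.
split; rewrite ?e1 ?e2//; first by rewrite -map_mxstar// z1.
move=> e f e0 fccp /=; rewrite -map_mxsand -map_mx_comp.
exact: (zf e (f \o w) e0 (ccp_comp wccp fccp)).
Qed.

(** * Initial structures *)

Section MatrixNormBound.
Variables (R : realType) (E : moData R).
Hypothesis Eop : norm_axioms E.
Hypothesis Eruan : ruan_axioms E.

Lemma mo_norm_sum n I (r : seq I) (P : pred I) (x : I -> 'M[E]_n) :
  mo_norm (\sum_(i <- r | P i) x i) <= \sum_(i <- r | P i) mo_norm (x i).
Proof.
apply: (big_ind2 (fun (y : 'M[E]_n) a => mo_norm y <= a)) => //.
  by rewrite mo_norm0.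
move=> y a z b ya zb; have [_ /(_ y z) + _] := Eop n => /le_trans; apply.
exact: lerD.
Qed.

Lemma mxsand_delta n (x : 'M[E]_n) :
  x = \sum_i \sum_j mxsand (delta_mx i 0 : 'cV[R[i]]_n)
        (const_mx (x i j) : 'M[E]_1) (delta_mx 0 j : 'rV[R[i]]_n).
Proof.
apply/matrixP => i j; rewrite summxE (bigD1 i)//= summxE (bigD1 j)//=.
rewrite mxE !big_ord1 !mxE !eqxx mulr1 scale1r !big1 ?addr0// => [k ki|l lj].
  rewrite summxE big1// => l _.
  by rewrite mxE !big_ord1 !mxE eq_sym (negbTE ki) mul0r scale0r.
by rewrite mxE !big_ord1 !mxE !eqxx [j == l]eq_sym (negbTE lj) mulr0 scale0r.
Qed.

Lemma mo_norm_le_entries n (x : 'M[E]_n) :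
  mo_norm x <= \sum_i \sum_j opnorm (delta_mx i 0 : 'cV[R[i]]_n) *
    nrm (x i j) * opnorm (delta_mx 0 j : 'rV[R[i]]_n).
Proof.
rewrite [in leLHS](mxsand_delta x).
apply: le_trans (mo_norm_sum _ _ _) _; apply: ler_sum => i _.
apply: le_trans (mo_norm_sum _ _ _) _; apply: ler_sum => j _.
by have [_] := Eruan; apply.
Qed.

End MatrixNormBound.

Section InitialStructure.
Variables (R : realType) (V : lmodType R[i]) (st : V -> V).
Variable F : forall T : moData R, {linear V -> T} -> Prop.

(** The smallest matrix norm making every map of the family [F] contractive.
    The family may range over all operator systems, because the set of reals
    below quantifies over it inside [Prop]. *)
Definition initial_norm n (x : 'M[V]_n) : R :=
  sup [set r | exists (T : moData R) (w : {linear V -> T}),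
                 F w /\ r = mo_norm (map_mx w x)].

(** The largest cone making every map of the family [F] positive. *)
Definition initial_pos n (x : 'M[V]_n) : Prop :=
  forall (T : moData R) (w : {linear V -> T}), F w -> mo_pos (map_mx w x).

(** The space [V] with involution [st] and the initial structure for [F]. *)
Definition initial : moData R :=
  @MoData R V st initial_norm initial_pos.

Hypothesis F_opsys : forall (T : moData R) (w : {linear V -> T}),
  F w -> operator_system T.
Hypothesis F_star : forall (T : moData R) (w : {linear V -> T}), F w ->
  forall x, w (st x) = mo_star (w x).
Hypothesis F_bounded : forall x, exists M,
  forall (T : moData R) (w : {linear V -> T}), F w -> nrm (w x) <= M.
Hypothesis F_sep : forall x,
  (forall (T : moData R) (w : {linear V -> T}), F w -> w x = 0) -> x = 0.

Lemma initial_eq x y :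
  (forall (T : moData R) (w : {linear V -> T}), F w -> w x = w y) -> x = y.
Proof.
move=> xy; apply/eqP; rewrite -subr_eq0; apply/eqP/F_sep => T w Fw.
by rewrite linearB (xy _ _ Fw) subrr.
Qed.

Lemma initial_mx_eq m n (x y : 'M[V]_(m, n)) :
  (forall (T : moData R) (w : {linear V -> T}),
    F w -> map_mx w x = map_mx w y) -> x = y.
Proof.
move=> xy; apply/matrixP => i j; apply: initial_eq => T w Fw.
by have /matrixP/(_ i j) := xy _ _ Fw; rewrite !mxE.
Qed.

Lemma initial_mx_bounded n (x : 'M[V]_n) : exists M,
  forall r, [set r | exists (T : moData R) (w : {linear V -> T}),
                 F w /\ r = mo_norm (map_mx w x)] r -> r <= M.
Proof.
have [M MP] := choice F_bounded.
exists (\sum_i \sum_j opnorm (delta_mx i 0 : 'cV[R[i]]_n) * M (x i j) *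
  opnorm (delta_mx 0 j : 'rV[R[i]]_n)) => _ [T [w [Fw ->]]].
have [[[_ Tn Tr _] _] _ _] := F_opsys Fw.
apply: le_trans (mo_norm_le_entries Tn Tr _) _.
apply: ler_sum => i _; apply: ler_sum => j _.
apply: ler_wpM2r; first exact: opnorm_ge0.
by apply: ler_wpM2l; rewrite ?opnorm_ge0// mxE MP.
Qed.

Lemma initial_norm_ge (T : moData R) (w : {linear V -> T}) n (x : 'M[V]_n) :
  F w -> mo_norm (map_mx w x) <= initial_norm x.
Proof.
move=> Fw; have [M xM] := initial_mx_bounded x; apply: (sup_ge_of xM).
by exists T, w.
Qed.

Lemma initial_norm_le n (x : 'M[V]_n) M : 0 <= M ->
  (forall (T : moData R) (w : {linear V -> T}),
    F w -> mo_norm (map_mx w x) <= M) ->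
  initial_norm x <= M.
Proof.
by move=> M0 xM; apply: sup_le_of => // _ [T [w [Fw ->]]]; apply: xM.
Qed.

Lemma initial_norm_nneg n (x : 'M[V]_n) : 0 <= initial_norm x.
Proof.
have [M xM] := initial_mx_bounded x; apply: sup_nneg xM => _ [T [w [Fw ->]]].
by have [[[_ Tn _ _] _] _ _] := F_opsys Fw; apply: mo_norm_ge0.
Qed.

Lemma initial_norm_axioms : norm_axioms initial.
Proof.
move=> n; have le_scale (c : R[i]) (x : 'M[V]_n) :
    initial_norm (map_mx (fun e => c *: e) x) <= Normc.normc c * initial_norm x.
  apply: initial_norm_le => [|T w Fw].
    by rewrite mulr_ge0 ?normc_ge0 ?initial_norm_nneg.
  have [[[_ Tn _ _] _] _ _] := F_opsys Fw; have [_ _ TZ] := Tn n.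
  rewrite (_ : map_mx w _ = map_mx (fun e : T => c *: e) (map_mx w x)).
    by rewrite TZ ler_wpM2l ?normc_ge0 ?initial_norm_ge.
  by apply/matrixP => i j; rewrite !mxE linearZ.
split=> [x x0|x y|c x].
- apply: initial_mx_eq => T w Fw.
  have [[[_ Tn _ _] _] _ _] := F_opsys Fw; have [T0 _ _] := Tn n.
  rewrite (T0 (map_mx w x)) ?map_mx0//; apply/eqP.
  rewrite eq_le mo_norm_ge0// andbT -[X in _ <= X]x0; exact: initial_norm_ge.
- apply: initial_norm_le => [|T w Fw].
    by rewrite addr_ge0 ?initial_norm_nneg.
  have [[[_ Tn _ _] _] _ _] := F_opsys Fw; have [_ TD _] := Tn n.
  rewrite map_mxD; apply: le_trans (TD _ _) _.
  by rewrite lerD ?initial_norm_ge.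
- apply/eqP; rewrite eq_le le_scale/=.
  have [->|c0] := eqVneq c 0.
    by rewrite Normc.normc0 mul0r initial_norm_nneg.
  have cp : 0 < Normc.normc c.
    rewrite lt_def normc_ge0 andbT; apply: contra c0 => /eqP/Normc.eq0_normc ->.
    by [].
  rewrite mulrC -ler_pdivlMr// mulrC -Normc.normcV.
  rewrite [in leLHS](_ : x = map_mx (fun e => c^-1 *: e)
                               (map_mx (fun e => c *: e) x)).
    exact: le_scale.
  by apply/matrixP => i j; rewrite !mxE scalerA mulVf// scale1r.
Qed.

Lemma initial_ruan_axioms : ruan_axioms initial.
Proof.
split=> [m n x y|m n A x B].
- apply/eqP; rewrite eq_le; apply/andP; split.
    apply: initial_norm_le => [|T w Fw].
      by rewrite le_max initial_norm_nneg.
    have [[[_ _ [Tm _] _] _] _ _] := F_opsys Fw.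
    rewrite map_block_mx !map_mx0 Tm ge_max !le_max.
    by rewrite !initial_norm_ge ?orbT.
  rewrite ge_max; apply/andP; split; apply: initial_norm_le;
    rewrite ?initial_norm_nneg// => T w Fw;
    have [[[_ _ [Tm _] _] _] _ _] := F_opsys Fw;
    apply: le_trans (initial_norm_ge (block_mx x 0 0 y) Fw);
    by rewrite map_block_mx !map_mx0 Tm le_max lexx ?orbT.
- apply: initial_norm_le => [|T w Fw].
    by rewrite !mulr_ge0 ?opnorm_ge0 ?initial_norm_nneg.
  have [[[_ _ [_ Ts] _] _] _ _] := F_opsys Fw.
  rewrite (map_mxsand (E := initial)); apply: le_trans (Ts _ _ _ _ _) _.
  apply: ler_wpM2r; first exact: opnorm_ge0.
  by apply: ler_wpM2l; rewrite ?opnorm_ge0// initial_norm_ge.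
Qed.

Lemma initial_star_axioms : star_axioms initial.
Proof.
split=> [x|x y|c x]; apply: initial_eq => T w Fw;
  have [[[[sK sD sZ] _ _ _] _] _ _] := F_opsys Fw;
  rewrite /= ?linearD ?linearZ/=.
- by rewrite !(F_star Fw) sK.
- by rewrite !(F_star Fw) linearD sD.
- by rewrite !(F_star Fw) linearZ sZ.
Qed.

Lemma initial_map_mxstar (T : moData R) (w : {linear V -> T}) n
    (x : 'M[initial]_n) :
  F w -> map_mx w (mxstar x) = mxstar (map_mx w x).
Proof.
by move=> Fw; apply/matrixP => i j; rewrite !mxE /= (F_star Fw).
Qed.

Lemma initial_matrix_ordered : matrix_ordered_operator_space initial.
Proof.
split; split.
- exact: initial_star_axioms.
- exact: initial_norm_axioms.
- exact: initial_ruan_axioms.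
- move=> n x; apply/eqP; rewrite eq_le; apply/andP; split;
    (apply: initial_norm_le => [|T w Fw]; first exact: initial_norm_nneg);
    have [[[_ _ _ Ts] _] _ _] := F_opsys Fw.
    by rewrite initial_map_mxstar// Ts initial_norm_ge.
  rewrite -Ts -initial_map_mxstar//; exact: initial_norm_ge.
- move=> n x x0; apply: initial_mx_eq => T w Fw.
  have [[_ [Tsa _ _ _ _]] _ _] := F_opsys Fw.
  by rewrite initial_map_mxstar// Tsa//; apply: x0.
- move=> n x y x0 y0 T w Fw; have [[_ [_ TD _ _ _]] _ _] := F_opsys Fw.
  by rewrite map_mxD; apply: TD; [apply: x0|apply: y0].
- move=> n x; split=> [[x0 x1]|-> ].
    apply: initial_mx_eq => T w Fw.
    have [[_ [_ _ Tp _ _]] _ _] := F_opsys Fw.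
    rewrite map_mx0; apply/Tp; split; first exact: x0.
    by rewrite -map_mxN; apply: x1.
  suff p0 : initial_pos (0 : 'M[V]_n) by rewrite oppr0.
  move=> T w Fw; have [[_ [_ _ Tp _ _]] _ _] := F_opsys Fw.
  by rewrite map_mx0; have [_ /(_ erefl)[]] := Tp n 0.
- move=> m n A x x0 T w Fw; have [[_ [_ _ _ Ts _]] _ _] := F_opsys Fw.
  by rewrite (map_mxsand (E := initial)); apply: Ts; apply: x0.
- move=> n x xP T w Fw; have [[_ [_ _ _ _ Tc]] _ _] := F_opsys Fw.
  apply: Tc => e e0; have [p p0 xp] := xP _ e0; exists (map_mx w p).
    exact: p0.
  rewrite -map_mxB; apply: le_lt_trans xp; exact: initial_norm_ge.
Qed.

Lemma initial_ccp (T : moData R) (w : {linear V -> T}) :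
  F w -> ccp (w : {linear initial -> T}).
Proof.
move=> Fw; split; first by move=> n x; apply: initial_norm_ge.
by split=> [x|n x]; [apply: F_star|apply].
Qed.

(** An initial structure inherits complete isometry from the family: a map [w]
    of [F] into [T] only decreases the norm of the partial unitization, which
    on [T] is the norm of [T], and the norm is the supremum over such [w]. *)
Lemma initial_sharp_isometric :
  completely_isometric
    (@sharp_incl R initial : {linear initial -> sharp initial}).
Proof.
move=> n x; apply/eqP; rewrite eq_le sharp_norm_le/=; last first.
  exact: initial_matrix_ordered.
apply: initial_norm_le => [|T w Fw].
  apply: lb_le_inf; last exact: sharp_norm_set_lbound.
  exact: sharp_norm_set_nonempty initial_matrix_ordered _ x.
have [_ _ <-] := F_opsys Fw.
apply: lb_le_inf.
  exact: sharp_norm_set_nonempty initial_matrix_ordered _ x.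
(* Any t admissible for x in the initial structure is admissible for w x. *)
move=> t [t0 tp]; apply: ge_inf.
  by exists 0; exact: sharp_norm_set_lbound.
split=> //; have := sharp_pos_map (initial_ccp Fw) tp.
congr sharp_pos; rewrite map_block_mx; congr block_mx; apply/matrixP => i j.
- by rewrite !mxE /= linear0.
- by rewrite !mxE.
- by rewrite !mxE /sharp_star /= (F_star Fw).
- by rewrite !mxE /= linear0.
Qed.

End InitialStructure.

(** * Quotient modules *)

Section QuotientModule.
Local Open Scope quotient_scope.
Variables (K : pzRingType) (V : lmodType K) (N : submodClosed V).

(** [N] again, as an additive subgroup: closure under opposites, which scaling
    by [-1] provides, is not part of the structure of [N]. *)
Definition lquot_pred : {pred V} := fun v => v \in N.

HB.instance Definition _ := GRing.isZmodClosed.Build V lquot_pred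
  (GRing.submod_closedB (submodClosedP N)).

(** The module [V / N]. *)
Definition lquot := Quotient.quot lquot_pred.

HB.instance Definition _ := GRing.Zmodule.on lquot.

(** The canonical projection. *)
Definition lquot_pi (v : V) : lquot := \pi_(Quotient.quot lquot_pred) v.

Lemma lquot_piE (u v : V) : (lquot_pi u == lquot_pi v) = (u - v \in N).
Proof. by rewrite /lquot_pi -Quotient.idealrBE. Qed.

Lemma lquot_pi_surj (q : lquot) : exists v, q = lquot_pi v.
Proof. by exists (repr q); rewrite /lquot_pi reprK. Qed.

Lemma lquot_piD : {morph lquot_pi : u v / u + v}.
Proof. by move=> u v; rewrite /lquot_pi raddfD. Qed.

Definition lquot_scale (c : K) (q : lquot) : lquot := lquot_pi (c *: repr q).

Lemma lquot_piZ c v : lquot_scale c (lquot_pi v) = lquot_pi (c *: v).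
Proof.
apply/eqP; rewrite lquot_piE -scalerBr rpredZ// -lquot_piE.
by apply/eqP; rewrite /lquot_pi reprK.
Qed.

Lemma lquot_scaleA a b q :
  lquot_scale a (lquot_scale b q) = lquot_scale (a * b) q.
Proof. by have [v ->] := lquot_pi_surj q; rewrite !lquot_piZ scalerA. Qed.

Lemma lquot_scale1 : left_id 1 lquot_scale.
Proof.
by move=> q; have [v ->] := lquot_pi_surj q; rewrite lquot_piZ scale1r.
Qed.

Lemma lquot_scaleDr : right_distributive lquot_scale +%R.
Proof.
move=> c q r; have [v ->] := lquot_pi_surj q; have [w ->] := lquot_pi_surj r.
by rewrite -lquot_piD !lquot_piZ scalerDr lquot_piD.
Qed.

Lemma lquot_scaleDl q : {morph lquot_scale^~ q : a b / a + b}.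
Proof.
move=> a b; have [v ->] := lquot_pi_surj q.
by rewrite !lquot_piZ scalerDl lquot_piD.
Qed.

HB.instance Definition _ := GRing.Zmodule_isLmodule.Build K lquot
  lquot_scaleA lquot_scale1 lquot_scaleDr lquot_scaleDl.

Lemma lquot_pi_is_linear : linear lquot_pi.
Proof. by move=> c u v; rewrite lquot_piD -lquot_piZ. Qed.

HB.instance Definition _ := GRing.isLinear.Build K V lquot *:%R lquot_pi
  lquot_pi_is_linear.

End QuotientModule.

(** * Cauchy sequences for the morphisms vanishing on J *)

Section QuotientSpace.
Variables (R : realType) (S : moData R) (J : set S).

(** The morphisms of operator systems on [S] that vanish on [J]. *)
Definition admissible (T : moData R) (g : {linear S -> T}) : Prop :=
  [/\ operator_system T, ccp g & forall x, J x -> g x = 0].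

(** Sequences that every admissible morphism maps to a Cauchy sequence,
    uniformly in the morphism and its target; in other words, Cauchy for the
    seminorm [x |-> sup_g ||g x||]. *)
Definition cauchy (u : nat -> S) : Prop := forall e : R, 0 < e ->
  exists N, forall m n, (N <= m)%N -> (N <= n)%N ->
  forall (T : moData R) (g : {linear S -> T}), admissible g ->
    nrm (g (u m) - g (u n)) <= e.

(** Sequences that tend to [0] for the same seminorm. *)
Definition null (u : nat -> S) : Prop := forall e : R, 0 < e ->
  exists N, forall n, (N <= n)%N ->
  forall (T : moData R) (g : {linear S -> T}), admissible g ->
    nrm (g (u n)) <= e.

Lemma admissible_norm (T : moData R) (g : {linear S -> T}) :
  admissible g -> norm_axioms T.
Proof. by case=> -[[[_ Tn _ _] _] _ _] _ _. Qed.

Lemma scale_eps (c : R[i]) (e : R) : 0 < e ->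
  exists2 d : R, 0 < d & forall r, r <= d -> Normc.normc c * r <= e.
Proof.
move=> e0; have c1 : 0 < Normc.normc c + 1 by rewrite ltr_wpDl ?normc_ge0.
exists (e / (Normc.normc c + 1)); first by rewrite divr_gt0.
move=> r rd; apply: (le_trans (ler_wpM2l (normc_ge0 c) rd)).
by rewrite mulrCA ler_piMr ?(ltW e0)// ler_pdivrMr// mul1r lerDl.
Qed.

Definition cauchy_pred : {pred nat -> S} := fun u => `[< cauchy u >].

Lemma cauchy_submod : submod_closed cauchy_pred.
Proof.
split=> [|c u v /asboolP uc /asboolP vc]; apply/asboolP => e e0.
  exists 0%N => m n _ _ T g gadm.
  by rewrite linear0 subr0 (nrm0 (admissible_norm gadm)) ltW.
have e2 : 0 < e / 2 by rewrite divr_gt0.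
have [d d0 dc] := scale_eps c e2.
have [N uN] := uc _ d0; have [M vM] := vc _ e2.
exists (maxn N M) => m n.
rewrite !geq_max => /andP[Nm Mm] /andP[Nn Mn] T g gadm.
have Tn := admissible_norm gadm.
have -> : g ((c *: u + v) m) - g ((c *: u + v) n) =
    c *: (g (u m) - g (u n)) + (g (v m) - g (v n)).
  have gE k : g ((c *: u + v) k) = c *: g (u k) + g (v k) by rewrite -linearP.
  by rewrite !gE scalerBr opprD addrACA.
apply: (le_trans (nrmD Tn _ _)); rewrite [e]splitr lerD//.
  by rewrite nrmZ// dc// uN.
exact: vM.
Qed.

HB.instance Definition _ :=
  GRing.isSubmodClosed.Build R[i] (nat -> S) cauchy_pred cauchy_submod.

(** The module of Cauchy sequences. *)
Record cauchy_seq :=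
  CauchySeq { cauchy_seq_val :> nat -> S; _ : cauchy_seq_val \in cauchy_pred }.
HB.instance Definition _ := [isSub for cauchy_seq_val].
HB.instance Definition _ := [Choice of cauchy_seq by <:].
HB.instance Definition _ := [SubChoice_isSubLmodule of cauchy_seq by <:].

Definition null_pred : {pred cauchy_seq} := fun u => `[< null u >].

Lemma null_submod : submod_closed null_pred.
Proof.
split=> [|c u v /asboolP uc /asboolP vc]; apply/asboolP => e e0.
  exists 0%N => n _ T g gadm.
  by rewrite linear0 (nrm0 (admissible_norm gadm)) ltW.
have e2 : 0 < e / 2 by rewrite divr_gt0.
have [d d0 dc] := scale_eps c e2.
have [N uN] := uc _ d0; have [M vM] := vc _ e2.
exists (maxn N M) => n; rewrite !geq_max => /andP[Nn Mn] T g gadm.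
have Tn := admissible_norm gadm.
have -> : g ((c *: u + v : cauchy_seq) n) = c *: g (u n) + g (v n).
  by rewrite -linearP.
apply: (le_trans (nrmD Tn _ _)); rewrite [e]splitr lerD//.
  by rewrite nrmZ// dc// uN.
exact: vM.
Qed.

HB.instance Definition _ :=
  GRing.isSubmodClosed.Build R[i] cauchy_seq null_pred null_submod.

(** The separated completion of [S] for the seminorm [x |-> sup_g ||g x||]. *)
Definition qspace : lmodType R[i] := lquot null_pred.
End QuotientSpace.

(** * The quotient operator system *)

Section QuotientSystem.
Variables (R : realType) (S : moData R) (J : set S).
Local Notation qspace := (qspace J).
Local Notation admissible := (admissible J).
Implicit Types (u v : cauchy_seq J).

(** The class of a Cauchy sequence, to be thought of as its limit. *)
Definition qclass (u : cauchy_seq J) : qspace :=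
  lquot_pi (null_pred (J := J)) u.

Lemma qclass_is_linear : linear qclass.
Proof. exact: lquot_pi_is_linear. Qed.

HB.instance Definition _ := GRing.isLinear.Build R[i] (cauchy_seq J) qspace *:%R
  qclass qclass_is_linear.

Lemma qclass_surj (q : qspace) : exists u, q = qclass u.
Proof. exact: lquot_pi_surj. Qed.

Lemma qclass_eq u v : qclass u = qclass v <-> null J (fun n => u n - v n).
Proof.
split=> [/eqP|uv]; first by rewrite lquot_piE => /asboolP.
by apply/eqP; rewrite lquot_piE; apply/asboolP.
Qed.

Lemma cauchy_seqP u : cauchy J u.
Proof. by apply/asboolP; case: u. Qed.

Lemma cauchy_cst (x : S) : (fun _ : nat => x) \in cauchy_pred J.
Proof.
apply/asboolP => e e0; exists 0%N => m n _ _ T g /admissible_norm Tn.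
by rewrite subrr nrm0// ltW.
Qed.

(** The canonical map from [S], the class of a constant sequence. *)
Definition qembed (x : S) : qspace := qclass (CauchySeq (cauchy_cst x)).

Lemma qembed_is_linear : linear qembed.
Proof.
by move=> c x y; rewrite /qembed -linearP; congr qclass; apply: val_inj.
Qed.

HB.instance Definition _ := GRing.isLinear.Build R[i] S qspace *:%R qembed
  qembed_is_linear.

Lemma cauchy_star u : (fun n => mo_star (u n)) \in cauchy_pred J.
Proof.
apply/asboolP => e e0; have [N uN] := cauchy_seqP u e0.
exists N => m n Nm Nn T g gadm; have [[[Tsa _] _ _] [_ [gs _]] _] := gadm.
have [Tst _ _ _] := Tsa.
by rewrite !gs -starB// nrm_star// uN.
Qed.

(** The involution, computed termwise on a chosen representative. *)
Definition qstar (q : qspace) : qspace :=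
  qclass (CauchySeq (cauchy_star (sval (cid (qclass_surj q))))).

(** [w] maps the class of [u] to the limit of its values on the terms of [u]. *)
Definition qcontinuous (T : moData R) (w : {linear qspace -> T}) : Prop :=
  forall u (e : R), 0 < e -> exists N, forall n, (N <= n)%N ->
    nrm (w (qclass u) - w (qembed (u n))) <= e.

(** The continuous extensions to [qspace] of the admissible morphisms. *)
Definition qfamily (T : moData R) (w : {linear qspace -> T}) : Prop :=
  admissible (w \o qembed) /\ qcontinuous w.

Lemma qfamily_norm (T : moData R) (w : {linear qspace -> T}) :
  qfamily w -> norm_axioms T.
Proof. by case=> /admissible_norm. Qed.

Lemma qfamily_opsys (T : moData R) (w : {linear qspace -> T}) :
  qfamily w -> operator_system T.
Proof. by case=> -[]. Qed.

(** Continuity holds at a rate that depends on the sequence only. *)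
Lemma qfamily_uniform u (e : R) : 0 < e -> exists N, forall n, (N <= n)%N ->
  forall (T : moData R) (w : {linear qspace -> T}), qfamily w ->
    nrm (w (qclass u) - w (qembed (u n))) <= e.
Proof.
move=> e0; have [N uN] := cauchy_seqP u e0; exists N => n Nn T w [wadm wc].
have Tn := admissible_norm wadm.
apply/ler_addgt0Pl => d d0; have [M uM] := wc u _ d0.
apply: (le_trans (nrmB_trans Tn _ (w (qembed (u (maxn N M)))) _)).
by apply: lerD; [apply: uM; rewrite leq_maxr|apply: uN wadm; rewrite ?leq_maxl].
Qed.

Lemma qfamily_star (T : moData R) (w : {linear qspace -> T}) : qfamily w ->
  forall q, w (qstar q) = mo_star (w q).
Proof.
move=> wF q; rewrite /qstar; case: cid => u /= ->.
have [[[[Tsa _] _ _] [_ [ws _]] _] wc] := wF.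
have Tn := qfamily_norm wF; have [Tst _ _ _] := Tsa.
apply/eqP; rewrite -subr_eq0; apply/eqP; apply: (nrm_le_eps Tn) => e e0.
have e2 : 0 < e / 2 by rewrite divr_gt0.
have [N uN] := wc u _ e2.
have [M uM] := wc (CauchySeq (cauchy_star u)) _ e2.
set n := maxn N M.
apply: (le_trans (nrmB_trans Tn _ (w (qembed (mo_star (u n)))) _)).
rewrite [e]splitr; apply: lerD; first by apply: uM; rewrite leq_maxr.
have /= -> := ws (u n); rewrite -starB// nrm_star// nrmBC//.
by apply: uN; rewrite leq_maxl.
Qed.

Lemma qfamily_bounded q : exists M,
  forall (T : moData R) (w : {linear qspace -> T}), qfamily w -> nrm (w q) <= M.
Proof.
have [u ->] := qclass_surj q; have [N uN] := qfamily_uniform u ltr01.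
exists (1 + nrm (u N)) => T w wF; have Tn := qfamily_norm wF.
rewrite -[w _](subrK (w (qembed (u N)))).
apply: (le_trans (nrmD Tn _ _)); apply: lerD; first exact: uN.
by have [[_ [wc _] _] _] := wF; apply: nrm_contractive wc.
Qed.

Lemma qcontinuous_eq (T : moData R) (w w' : {linear qspace -> T}) :
  norm_axioms T -> qcontinuous w -> qcontinuous w' ->
  (forall x, w (qembed x) = w' (qembed x)) -> w =1 w'.
Proof.
move=> Tn wc wc' ww' q; have [u ->] := qclass_surj q.
apply/eqP; rewrite -subr_eq0; apply/eqP; apply: (nrm_le_eps Tn) => e e0.
have e2 : 0 < e / 2 by rewrite divr_gt0.
have [N uN] := wc u _ e2; have [M uM] := wc' u _ e2.
set n := maxn N M.
apply: (le_trans (nrmB_trans Tn _ (w (qembed (u n))) _)).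
rewrite [e]splitr; apply: lerD; first by apply: uN; rewrite leq_maxl.
by rewrite ww' nrmBC// uM// leq_maxr.
Qed.

Section Extension.
Variables (T : moData R) (g : {linear S -> T}).
Hypothesis gadm : admissible g.

(** [g (u n)] tends to [l]. *)
Let converges (u : nat -> S) (l : T) := forall e : R, 0 < e ->
  exists N, forall n, (N <= n)%N -> nrm (g (u n) - l) <= e.

Let converges_eq u v l l' : converges u l -> converges v l' ->
  null J (fun n => u n - v n) -> l = l'.
Proof.
have Tn := admissible_norm gadm.
move=> ul vl' uv; apply/eqP; rewrite -subr_eq0; apply/eqP.
apply: (nrm_le_eps Tn) => e e0; have e3 : 0 < e / 3 by rewrite divr_gt0.
have [N uN] := ul _ e3; have [M vM] := vl' _ e3; have [K uvK] := uv _ e3.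
set n := maxn K (maxn N M).
apply: (le_trans (nrmB_trans Tn _ (g (u n)) _)).
rewrite (_ : e = e / 3 + (e / 3 + e / 3)); last by field.
apply: lerD; first by rewrite nrmBC// uN// /n !leq_max leqnn !orbT.
apply: (le_trans (nrmB_trans Tn _ (g (v n)) _)); apply: lerD.
  by rewrite -linearB uvK// leq_maxl.
by rewrite vM// /n !leq_max leqnn !orbT.
Qed.

Let converges_exists u : exists l, converges u l.
Proof.
have [[_ Tc _] _ _] := gadm; have Tn := admissible_norm gadm.
have [e e0|l gl] := Tc (fun n => g (u n)).
  have e2 : 0 < e / 2 by rewrite divr_gt0.
  have [N uN] := cauchy_seqP u e2; exists N => m n Nm Nn.
  apply: (le_lt_trans (uN _ _ Nm Nn _ _ gadm)).
  by rewrite ltr_pdivrMr// ltr_pMr// ltr1n.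
exists l => e e0; have [N lN] := gl _ e0; exists N => n Nn.
exact/ltW/lN.
Qed.

(** Admissible morphisms extend by continuity, their targets being complete. *)
Lemma qextend : exists2 w : {linear qspace -> T}, qfamily w &
  forall x, w (qembed x) = g x.
Proof.
have Tn := admissible_norm gadm.
have : forall q : qspace, exists l, forall u, q = qclass u -> converges u l.
  move=> q; have [u ->] := qclass_surj q; have [l ul] := converges_exists u.
  exists l => v /esym/qclass_eq uv; have [l' vl'] := converges_exists v.
  by rewrite -(converges_eq vl' ul uv).
move=> /choice[w wP].
have {}wP u : converges u (w (qclass u)) by exact: wP.
have w_lin : linear w.
  move=> c q r; have [u ->] := qclass_surj q; have [v ->] := qclass_surj r.
  rewrite -linearP/=; apply: (converges_eq (wP _) (v := c *: u + v)); last first.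
    move=> e e0; exists 0%N => n _ T' g' g'adm.
    by rewrite subrr linear0 (nrm0 (admissible_norm g'adm)) ltW.
  move=> e e0; have e2 : 0 < e / 2 by rewrite divr_gt0.
  have [d d0 dc] := scale_eps c e2.
  have [N uN] := wP u _ d0; have [M vM] := wP v _ e2.
  exists (maxn N M) => n; rewrite !geq_max => /andP[Nn Mn].
  have -> : g ((c *: u + v : cauchy_seq J) n) = c *: g (u n) + g (v n).
    by rewrite -linearP.
  rewrite opprD addrACA -scalerBr.
  apply: (le_trans (nrmD Tn _ _)); rewrite [e]splitr lerD//.
    by rewrite nrmZ// dc// uN.
  exact: vM.
pose W : {linear qspace -> T} := HB.pack w
  (GRing.isLinear.Build R[i] qspace T *:%R w w_lin).
have Wg x : W (qembed x) = g x.
  apply/esym/eqP; rewrite -subr_eq0; apply/eqP; apply: (nrm_le_eps Tn) => e e0.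
  by have [N] := wP (CauchySeq (cauchy_cst x)) _ e0; apply.
exists W => //; split; last first.
  move=> u e e0; have [N uN] := wP u _ e0; exists N => n Nn.
  by rewrite Wg nrmBC//; apply: uN.
have [To [gc [gs gp]] gJ] := gadm.
have Wmx n (x : 'M[S]_n) : map_mx (W \o qembed) x = map_mx g x.
  by apply/matrixP => i j; rewrite !mxE; apply: Wg.
split=> //; last by move=> x Jx; rewrite -(gJ _ Jx); apply: Wg.
split=> [n x|]; first by rewrite Wmx.
split=> [x|n x x0]; last by rewrite Wmx; apply: gp.
by rewrite [LHS]Wg gs -Wg.
Qed.

End Extension.

Lemma qfamily_sep q : (forall (T : moData R) (w : {linear qspace -> T}),
  qfamily w -> w q = 0) -> q = 0.
Proof.
have [u ->] := qclass_surj q => u0.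
rewrite -(linear0 qclass); apply/qclass_eq => e e0.
have [N uN] := qfamily_uniform u e0; exists N => n Nn T g gadm.
have [w wF wg] := qextend gadm.
have := uN _ Nn _ _ wF; rewrite u0// sub0r nrmN ?wg ?subr0//.
exact: admissible_norm gadm.
Qed.

(** The quotient of [S] by [J]: the completion with the initial structure for
    the extended morphisms. *)
Definition qsystem : moData R := initial qstar qfamily.

Lemma qsystem_matrix_ordered : matrix_ordered_operator_space qsystem.
Proof.
exact: (initial_matrix_ordered qfamily_opsys qfamily_star qfamily_bounded
  qfamily_sep).
Qed.

Lemma qsystem_norm : norm_axioms qsystem.
Proof. by have [[_ + _ _] _] := qsystem_matrix_ordered. Qed.

Lemma qsystem_dense u (e : R) : 0 < e -> exists N, forall n, (N <= n)%N ->
  nrm (qclass u - qembed (u n) : qsystem) <= e.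
Proof.
move=> e0; have [N uN] := qfamily_uniform u e0; exists N => n Nn.
apply: initial_norm_le => [|T w wF]; first exact: ltW.
rewrite (_ : map_mx w _ = const_mx (w (qclass u) - w (qembed (u n)))).
  exact: uN.
by apply/matrixP => i j; rewrite !mxE linearB.
Qed.

Lemma qfamily_contractive (T : moData R) (w : {linear qspace -> T}) q :
  qfamily w -> nrm (w q) <= nrm (q : qsystem).
Proof.
move=> wF; have [wc _] :=
  initial_ccp qfamily_opsys qfamily_star qfamily_bounded wF.
exact: (nrm_contractive (E := qsystem) q wc).
Qed.

Lemma qsystem_complete : complete_space qsystem.
Proof.
move=> q qc; have Qn := qsystem_norm.
have h n : 0 < n.+1%:R^-1 :> R by rewrite invr_gt0 ltr0n.
have : forall n, exists x, nrm (q n - qembed x : qsystem) <= n.+1%:R^-1.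
  move=> n; have [u ->] := qclass_surj (q n).
  by have [N uN] := qsystem_dense u (h n); exists (u N); apply: uN.
move=> /choice[x qx].
have small e : 0 < e -> exists N, forall n, (N <= n)%N ->
    nrm (q n - qembed (x n) : qsystem) <= e.
  move=> e0; exists (Num.truncn e^-1) => n Nn; apply: le_trans (qx n) _.
  rewrite -[leRHS]invrK lef_pV2 ?posrE ?ltr0n ?invr_gt0//.
  apply: ltW; apply: lt_le_trans (truncnS_gt _) _.
  by rewrite ler_nat.
have xc : x \in cauchy_pred J.
  apply/asboolP => e e0; have e3 : 0 < e / 3 by rewrite divr_gt0.
  have [N xN] := small _ e3; have [M qM] := qc _ e3.
  exists (maxn N M) => m n.
rewrite !geq_max => /andP[Nm Mm] /andP[Nn Mn] T g gadm.
  have Tn := admissible_norm gadm.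
  have [w wF wg] := qextend gadm; rewrite -!wg -linearB.
  apply: le_trans (qfamily_contractive _ wF) _.
  rewrite (_ : e = e / 3 + (e / 3 + e / 3)); last by field.
  apply: (le_trans (nrmB_trans Qn _ (q m) _)); apply: lerD.
    by rewrite (nrmBC Qn) xN.
  apply: (le_trans (nrmB_trans Qn _ (q n) _)); apply: lerD; last exact: xN.
  exact/ltW/qM.
exists (qclass (CauchySeq xc)) => e e0; have e3 : 0 < e / 3 by rewrite divr_gt0.
have [N xN] := small _ e3; have [M qM] := qsystem_dense (CauchySeq xc) e3.
exists (maxn N M) => n; rewrite geq_max => /andP[Nn Mn].
apply: (le_lt_trans (nrmB_trans Qn _ (qembed (x n)) _)).
apply: (@le_lt_trans _ _ (e / 3 + e / 3)); last first.
  by rewrite -mulrDl ltr_pdivrMr// -mulr2n mulr_natr ltr_pMn2l//.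
by apply: lerD; [apply: xN|rewrite (nrmBC Qn); apply: qM].
Qed.

Lemma qsystem_operator_system : operator_system qsystem.
Proof.
split; first exact: qsystem_matrix_ordered.
  exact: qsystem_complete.
exact: (initial_sharp_isometric qfamily_opsys qfamily_star qfamily_bounded
  qfamily_sep).
Qed.

Lemma qembed_ccp : norm_axioms S -> ccp (qembed : {linear S -> qsystem}).
Proof.
move=> Sn; split=> [n x|].
  apply: initial_norm_le => [|T w [[_ [wc _] _] _]]; first exact: mo_norm_ge0.
  by rewrite -map_mx_comp; apply: wc.
split=> [x|n x x0 T w [[_ [_ [_ wp]] _] _]]; last first.
  by rewrite -map_mx_comp; apply: wp.
apply: (initial_eq qfamily_sep) => T w wF.
rewrite [RHS](qfamily_star wF).
by have [[_ [_ [ws _]] _] _] := wF; apply: ws.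
Qed.

Lemma contractive_qcontinuous (T : moData R) (w : {linear qsystem -> T}) :
  completely_contractive w -> qcontinuous w.
Proof.
move=> wc u e e0; have [N uN] := qsystem_dense u e0; exists N => n Nn.
rewrite -linearB; apply: le_trans (uN _ Nn).
exact: (nrm_contractive (E := qsystem) _ wc).
Qed.

Lemma qsystem_is_quotient : norm_axioms S ->
  is_quotient J (qembed : {linear S -> qsystem}).
Proof.
move=> Sn; split; first exact: qsystem_operator_system.
- exact: qembed_ccp.
- by move=> x Jx; apply: qfamily_sep => T w [[_ _ wJ] _]; apply: wJ.
move=> T g To gccp gJ; have gadm : admissible g by [].
have [w wF wg] := qextend gadm.
exists w; split=> [|x|w' [wc' _] wg'].
- exact: (initial_ccp qfamily_opsys qfamily_star qfamily_bounded wF).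
- by rewrite wg.
apply: qcontinuous_eq.
- exact: admissible_norm gadm.
- exact: contractive_qcontinuous.
- by have [] := wF.
- by move=> x; rewrite wg; apply/esym/wg'.
Qed.

End QuotientSystem.

(** * Uniqueness of the quotient *)

Lemma is_quotient_endo (R : realType) (S : moData R) (J : set S)
    (Q : moData R) (f : {linear S -> Q}) (h : {linear Q -> Q}) :
  is_quotient J f -> ccp h -> (forall x, f x = h (f x)) -> h =1 id.
Proof.
move=> [Qo fccp fJ fU] hccp hf q; have [i [_ _ iU]] := fU _ _ Qo fccp fJ.
by rewrite (iU h)// -(iU idfun)//; apply: ccp_id.
Qed.

Lemma is_quotient_unique (R : realType) (S : moData R) (J : set S)
    (Q Q' : moData R) (f : {linear S -> Q}) (f' : {linear S -> Q'}) :
  is_quotient J f -> is_quotient J f' ->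
  exists (u : {linear Q -> Q'}) (v : {linear Q' -> Q}),
    ccp u /\ ccp v /\ cancel u v /\ cancel v u /\
    (forall x : S, f' x = u (f x)).
Proof.
move=> fQ fQ'; have [Qo fccp fJ fU] := fQ; have [Qo' fccp' fJ' fU'] := fQ'.
have [u [uccp uf _]] := fU _ _ Qo' fccp' fJ'.
have [v [vccp vf _]] := fU' _ _ Qo fccp fJ.
exists u, v; do !split=> //.
  apply: (is_quotient_endo (h := v \o u) fQ (ccp_comp uccp vccp)) => x.
  by rewrite /= -uf -vf.
apply: (is_quotient_endo (h := u \o v) fQ' (ccp_comp vccp uccp)) => x.
by rewrite /= -vf -uf.
Qed.

Theorem theorem4 (R : realType) (S : moData R) (J : set S)
    (S_opsys : operator_system S)
    (J_kernel : exists (T : moData R) (g : {linear S -> T}),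
        operator_system T /\ ccp g /\ (forall x : S, J x <-> g x = 0)) :
  exists (Q : moData R) (f : {linear S -> Q}),
    is_quotient J f /\
    forall (Q' : moData R) (f' : {linear S -> Q'}), is_quotient J f' ->
      exists (u : {linear Q -> Q'}) (v : {linear Q' -> Q}),
        ccp u /\ ccp v /\ cancel u v /\ cancel v u /\
        (forall x : S, f' x = u (f x)).
Proof.
have [[[_ Sn _ _] _] _ _] := S_opsys.
have SQ := qsystem_is_quotient J Sn.
exists (qsystem J), (@qembed R S J); split=> // Q' f'.
exact: is_quotient_unique SQ.
Qed.
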